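(* Let $T$ be a truss and let $(G_i)_{i\in I}$ be a family, with $I\neq\varnothing$, of non-empty heaps of $T$-modules. For every $i\in I$ fix a pointed $T$-module structure $(G_i,+)$ associated to $G_i$; fix an index $i_0\in I$ and a family of symbols $(b_i)_{i\in I\setminus\{i_0\}}$. Let $C$ be the heap of $T$-modules associated with the pointed $T$-module $\left(\bigoplus_{i\in I}G_i\right)\oplus F$, where $F$ is the free pointed $T$-module with basis $(b_i)_{i\in I\setminus\{i_0\}}$. Let $u_i\colon G_i\to\bigoplus_{i\in I}G_i$ be the canonical morphisms, and define $\upsilon_{i_0}=u_{i_0}$ and $\upsilon_i=u_i+b_i$ for all $i\in I\setminus\{i_0\}$ (as maps $G_i\to C$). Then $(C,(\upsilon_i)_{i\in I})$ is a coproduct of the family $(G_i)_{i\in I}$ in the category of heaps of $T$-modules.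
   Context: An abelian heap is a (possibly empty) set $H$ with a ternary operation $[-,-,-]$ satisfying $[a,b,[c,d,e]]=[[a,b,c],d,e]$, $[a,b,b]=a=[b,b,a]$ and $[a,b,c]=[c,b,a]$; heap morphisms preserve the bracket. A truss is an abelian heap $T$ with an associative binary multiplication such that $t[s,s',s'']=[ts,ts',ts'']$ and $[s,s',s'']t=[st,s't,s''t]$ (not assumed unital, possibly empty). A left $T$-module is an abelian heap $M$ with an action $\cdot\colon T\times M\to M$ with $t\cdot(t'\cdot m)=(tt')\cdot m$, $[t,t',t'']\cdot m=[t\cdot m,t'\cdot m,t''\cdot m]$, $t\cdot[m,n,e]=[t\cdot m,t\cdot n,t\cdot e]$. A heap of $T$-modules is an abelian heap $M$ (possibly empty) with an operation $T\times M\times M\to M$, $(t,m,n)\mapsto t\triangleright_m n$, such that for each $m\in M$ the map $(t,n)\mapsto t\triangleright_m n$ makes $M$ a left $T$-module, and $t\triangleright_m n=[t\triangleright_e n,t\triangleright_e m,m]$ for all $m,n,e\in M$, $t\in T$. Morphisms are heap morphisms $f$ with $f(t\triangleright_m n)=t\triangleright_{f(m)}f(n)$. A pointed $T$-module is an abelian group $G$ with a map $\cdot\colon T\times G\to G$ such that $t\cdot(t'\cdot g)=(tt')\cdot g$, $[t,t',t'']\cdot g=t\cdot g-t'\cdot g+t''\cdot g$ and $t\cdot(g+h)=t\cdot g+t\cdot h$. Morphisms are group homomorphisms $f$ with $f(t\cdot g)=t\cdot f(g)$. Direct sums of pointed $T$-modules are direct sums of abelian groups with component-wise action. The free pointed $T$-module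 with basis $(b_j)_{j\in J}$ is the value on $J$ of the left adjoint of the forgetful functor from pointed $T$-modules to sets (it exists), $b_j$ being the image of $j$ under the unit. A pointed $T$-module $G$ has an associated heap of $T$-modules with $[x,y,z]=x-y+z$ and $t\triangleright_x y=t\cdot y-t\cdot x+x$. Conversely, for a non-empty heap of $T$-modules $(M,\triangleright)$ and $e\in M$, an associated pointed $T$-module structure is the abelian group on $M$ with addition $x+y=[x,e,y]$ (zero $e$) and action $t\cdot x=t\triangleright_e x$. *)

(* Defs.v *)
From HB Require Import structures.
From mathcomp Require Import all_boot all_algebra ssrAC.
From mathcomp Require Import mathcomp_extra boolp classical_sets functions.
From mathcomp Require Import cardinality.

Set Implicit Arguments.
Unset Strict Implicit.
Unset Printing Implicit Defensive.
Import GRing.Theory.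
Local Open Scope classical_set_scope.
Local Open Scope ring_scope.

(** * Abelian heaps and trusses *)

(* Carriers of heaps and trusses are arbitrary types, possibly empty. *)
HB.mixin Record IsAbelianHeap (H : Type) := {
  brk : H -> H -> H -> H;
  brkA : forall a b c d e, brk a b (brk c d e) = brk (brk a b c) d e;
  brkrK : forall a b, brk a b b = a;
  brklK : forall a b, brk b b a = a;
  brkC : forall a b c, brk a b c = brk c b a
}.

#[short(type="abHeapType")]
HB.structure Definition AbelianHeap := {H of IsAbelianHeap H}.

Definition heap_morphism (H K : abHeapType) (f : H -> K) : Prop :=
  forall a b c, f (brk a b c) = brk (f a) (f b) (f c).

HB.mixin Record IsTruss T of AbelianHeap T := {
  tmul : T -> T -> T;
  tmulA : associative tmul;
  tmul_brkr : forall t a b c : T,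
    tmul t (brk a b c) = brk (tmul t a) (tmul t b) (tmul t c);
  tmul_brkl : forall a b c t : T,
    tmul (brk a b c) t = brk (tmul a t) (tmul b t) (tmul c t)
}.

#[short(type="trussType")]
HB.structure Definition Truss := {T of IsTruss T & AbelianHeap T}.

(** * Modules and heaps of modules *)

Record is_left_module (T : trussType) (M : abHeapType) (act : T -> M -> M) :
    Prop := IsLeftModule {
  lmod_actA : forall t t' m, act t (act t' m) = act (tmul t t') m;
  lmod_actDl : forall t t' t'' m,
    act (brk t t' t'') m = brk (act t m) (act t' m) (act t'' m);
  lmod_actDr : forall t m n e,
    act t (brk m n e) = brk (act t m) (act t n) (act t e)
}.

(* [tri t m n] is the element written t |>_m n: the second argument is the
   base point. *)
HB.mixin Record IsHeapOfModules (T : trussType) M of AbelianHeap M := {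
  tri : T -> M -> M -> M;
  tri_lmodule : forall m : M, is_left_module (fun t n => tri t m n);
  tri_base : forall (t : T) (m n e : M),
    tri t m n = brk (tri t e n) (tri t e m) m
}.

#[short(type="heapModType")]
HB.structure Definition HeapOfModules (T : trussType) :=
  {M of IsHeapOfModules T M & AbelianHeap M}.

Definition heapMod_morphism (T : trussType) (M N : heapModType T)
    (f : M -> N) : Prop :=
  heap_morphism f /\ forall t m n, f (tri t m n) = tri t (f m) (f n).

(** * Pointed modules *)

HB.mixin Record IsPointedModule (T : trussType) G of GRing.Zmodule G := {
  pact : T -> G -> G;
  pactA : forall (t t' : T) (g : G), pact t (pact t' g) = pact (tmul t t') g;
  pactDl : forall (t t' t'' : T) (g : G),
    pact (brk t t' t'') g = pact t g - pact t' g + pact t'' g;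
  pactDr : forall (t : T) (g h : G), pact t (g + h) = pact t g + pact t h
}.

#[short(type="pointedModType")]
HB.structure Definition PointedModule (T : trussType) :=
  {G of IsPointedModule T G & GRing.Zmodule G}.

Definition pointedMod_morphism (T : trussType) (G H : pointedModType T)
    (f : G -> H) : Prop :=
  {morph f : x y / x + y} /\ forall t g, f (pact t g) = pact t (f g).

(* (F, b) is a universal arrow from the set J to the forgetful functor from
   pointed T-modules to sets, i.e. F is the value at J of its left adjoint and
   b is the component at J of the unit. *)
Definition is_free_pointedMod (T : trussType) (J : Type)
    (F : pointedModType T) (b : J -> F) : Prop :=
  forall (G : pointedModType T) (f : J -> G),
    exists! h : F -> G, pointedMod_morphism h /\ forall j, h (b j) = f j.

Section PointedModuleTheory.
Context {T : trussType} {G : pointedModType T}.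
Implicit Types (t : T) (x y : G).

Lemma pact0 t : pact t (0 : G) = 0.
Proof. by apply: (addrI (pact t 0)); rewrite -pactDr !addr0. Qed.

Lemma pactN t x : pact t (- x) = - pact t x.
Proof. by apply/eqP; rewrite -addr_eq0 -pactDr addNr pact0. Qed.

Lemma pactB t x y : pact t (x - y) = pact t x - pact t y.
Proof. by rewrite pactDr pactN. Qed.

End PointedModuleTheory.

(** * The heap of modules associated with a pointed module *)

Definition assoc_heap (T : trussType) (G : pointedModType T) : Type := G.

Section AssocHeap.
Variables (T : trussType) (G : pointedModType T).
Local Notation H := (assoc_heap G).

Let gbrk (x y z : G) : G := x - y + z.
Let gtri (t : T) (x y : G) : G := pact t y - pact t x + x.

Let gbrkA a b c d e : gbrk a b (gbrk c d e) = gbrk (gbrk a b c) d e.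
Proof. by rewrite /gbrk !addrA. Qed.

Let gbrkrK a b : gbrk a b b = a.
Proof. by rewrite /gbrk subrK. Qed.

Let gbrklK a b : gbrk b b a = a.
Proof. by rewrite /gbrk subrr add0r. Qed.

Let gbrkC a b c : gbrk a b c = gbrk c b a.
Proof. by rewrite /gbrk (ACl (3*2*1)). Qed.

HB.instance Definition _ := IsAbelianHeap.Build H gbrkA gbrkrK gbrklK gbrkC.

Let subDD (u v w : G) : (u + w) - (v + w) = u - v.
Proof. by rewrite opprD addrACA subrr addr0. Qed.

Let gtri_lmodule (m : H) :
  is_left_module (fun (t : T) (n : H) => gtri t m n : H).
Proof.
split.
- by move=> t t' n; rewrite /gtri pactDr pactB !pactA addrK.
- move=> t t' t'' n; rewrite /gtri /brk /= /gbrk !pactDl.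
  by rewrite [in RHS]subDD !opprD !opprK !addrA (ACl (1*4*2*5*3*6*7)).
- move=> t a b c; rewrite /gtri /brk /= /gbrk !pactDr pactN.
  by rewrite [in RHS]subDD [in RHS]subDD !addrA.
Qed.

Let gtri_base (t : T) (m n e : H) :
  gtri t m n = brk (gtri t e n : H) (gtri t e m : H) m.
Proof.
rewrite /gtri /brk /= /gbrk; congr (_ + m).
by rewrite [in RHS]subDD opprB addrA subrK.
Qed.

HB.instance Definition _ :=
  IsHeapOfModules.Build T H gtri_lmodule gtri_base.

End AssocHeap.

(** * The pointed module associated with a heap of modules and an element *)

Definition pointed_at (T : trussType) (M : heapModType T) (e : M) : Type := M.

Section PointedAt.
Variables (T : trussType) (M : heapModType T) (e : M).
Local Notation P := (pointed_at e).

HB.instance Definition _ := gen_eqMixin P.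
HB.instance Definition _ := gen_choiceMixin P.

Let zero : P := e.
Let opp (x : P) : P := brk e x e.
Let add (x y : P) : P := brk x e y.

Let addA : associative add.
Proof. by move=> x y z; rewrite /add brkA. Qed.

Let addC : commutative add.
Proof. by move=> x y; rewrite /add brkC. Qed.

Let add0 : left_id zero add.
Proof. by move=> x; rewrite /add brklK. Qed.

Let addN : left_inverse zero opp add.
Proof. by move=> x; rewrite /add /opp -brkA brklK brkrK. Qed.

HB.instance Definition _ := GRing.isZmodule.Build P addA addC add0 addN.

Let act (t : T) (x : P) : P := tri t e x.

Let actA (t t' : T) (x : P) : act t (act t' x) = act (tmul t t') x.
Proof. exact: (lmod_actA (tri_lmodule (e : M))). Qed.

Let actDl (t t' t'' : T) (x : P) :
  act (brk t t' t'') x = act t x - act t' x + act t'' x.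
Proof.
rewrite /act (lmod_actDl (tri_lmodule (e : M))).
by rewrite /GRing.add /= /add /GRing.opp /= /opp brkA brkrK -brkA brklK.
Qed.

Let trixx (t : T) (x : M) : tri t x x = x.
Proof. by rewrite (tri_base t x x x) brklK. Qed.

Let actDr (t : T) (x y : P) : act t (x + y) = act t x + act t y.
Proof.
by rewrite /act /GRing.add /= /add (lmod_actDr (tri_lmodule (e : M))) trixx.
Qed.

HB.instance Definition _ := IsPointedModule.Build T P actA actDl actDr.

End PointedAt.

(** * Direct sums of pointed modules *)

Section BinaryDirectSum.
Variables (T : trussType) (U V : pointedModType T).

Let act (t : T) (x : U * V) : U * V := (pact t x.1, pact t x.2).

Let actA (t t' : T) x : act t (act t' x) = act (tmul t t') x.
Proof. by rewrite /act /= !pactA. Qed.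

Let actDl (t t' t'' : T) x :
  act (brk t t' t'') x = act t x - act t' x + act t'' x.
Proof. by rewrite /act !pactDl. Qed.

Let actDr (t : T) x y : act t (x + y) = act t x + act t y.
Proof. by rewrite /act /= !pactDr. Qed.

HB.instance Definition _ :=
  IsPointedModule.Build T (U * V)%type actA actDl actDr.

End BinaryDirectSum.

Section DirectSum.
Variables (T : trussType) (I : Type) (G : I -> pointedModType T).

Record dsum : Type := DSum {
  dsum_fun :> forall i, G i;
  dsum_fin : finite_set [set i | dsum_fun i <> 0]
}.

Lemma dsumP (x y : dsum) : (forall i, x i = y i) -> x = y.
Proof.
case: x y => [x xfin] [y yfin] /= xy.
have {}xy : x = y by exact: functional_extensionality_dep.
by move: yfin; rewrite -xy => yfin; congr DSum; exact: Prop_irrelevance.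
Qed.

HB.instance Definition _ := gen_eqMixin dsum.
HB.instance Definition _ := gen_choiceMixin dsum.

Let zero_fin : finite_set [set i | (0 : G i) <> 0].
Proof. by apply: sub_finite_set (finite_set0 I) => i /=. Qed.

Let opp_fin (x : dsum) : finite_set [set i | - x i <> 0].
Proof.
by apply: sub_finite_set (dsum_fin x) => i /= + x0; apply; rewrite x0 oppr0.
Qed.

Let add_fin (x y : dsum) : finite_set [set i | x i + y i <> 0].
Proof.
apply: (@sub_finite_set _ _ ([set i | x i <> 0] `|` [set i | y i <> 0])).
  move=> i /= xy; have [x0|] := pselect (x i = 0); last by left.
  by right=> y0; apply: xy; rewrite x0 y0 addr0.
by rewrite finite_setU; split; exact: dsum_fin.
Qed.

Let zero := DSum zero_fin.
Let opp x := DSum (opp_fin x).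
Let add x y := DSum (add_fin x y).

Let addA : associative add.
Proof. by move=> x y z; apply: dsumP => i /=; rewrite addrA. Qed.

Let addC : commutative add.
Proof. by move=> x y; apply: dsumP => i /=; rewrite addrC. Qed.

Let add0 : left_id zero add.
Proof. by move=> x; apply: dsumP => i /=; rewrite add0r. Qed.

Let addN : left_inverse zero opp add.
Proof. by move=> x; apply: dsumP => i /=; rewrite addNr. Qed.

HB.instance Definition _ := GRing.isZmodule.Build dsum addA addC add0 addN.

Let act_fin (t : T) (x : dsum) : finite_set [set i | pact t (x i) <> 0].
Proof.
by apply: sub_finite_set (dsum_fin x) => i /= + x0; apply; rewrite x0 pact0.
Qed.

Let act (t : T) (x : dsum) := DSum (act_fin t x).

Let actA (t t' : T) x : act t (act t' x) = act (tmul t t') x.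
Proof. by apply: dsumP => i /=; rewrite pactA. Qed.

Let actDl (t t' t'' : T) x :
  act (brk t t' t'') x = act t x - act t' x + act t'' x.
Proof. by apply: dsumP => i /=; rewrite pactDl. Qed.

Let actDr (t : T) x y : act t (x + y) = act t x + act t y.
Proof. by apply: dsumP => i /=; rewrite pactDr. Qed.

HB.instance Definition _ := IsPointedModule.Build T dsum actA actDl actDr.

(* The index type is seen as [{classic I}] because [dfwith] tests equality of
   indices. *)
Let inj_fun (i : I) (x : G i) : forall j, G j :=
  @dfwith {classic I} G (fun=> 0) i x.

Let inj_fin (i : I) (x : G i) : finite_set [set j | inj_fun x j <> 0].
Proof.
apply: sub_finite_set (finite_set1 i) => j /= xj; apply: contrapT => ij.
apply: xj; rewrite /inj_fun (@dfwithout {classic I})//.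
by apply/eqP => /esym.
Qed.

Definition dsum_inj (i : I) (x : G i) : dsum := DSum (inj_fin x).

End DirectSum.

(** * Coproducts of heaps of modules *)

Definition is_coproduct (T : trussType) (I : Type) (G : I -> heapModType T)
    (C : heapModType T) (u : forall i, G i -> C) : Prop :=
  (forall i, heapMod_morphism (u i)) /\
  forall (H : heapModType T) (f : forall i, G i -> H),
    (forall i, heapMod_morphism (f i)) ->
    exists! h : C -> H,
      heapMod_morphism h /\ forall i (x : G i), h (u i x) = f i x.

Section Candidate.
Variables (T : trussType) (I : Type) (G : I -> heapModType T).
Variables (e : forall i, G i) (i0 : I).
Variables (F : pointedModType T) (b : {i : I | i <> i0} -> F).

Definition coprod_sum : pointedModType T :=
  dsum (fun i => pointed_at (e i) : pointedModType T).

Definition coprod_pointed : pointedModType T := (coprod_sum * F)%type.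

Definition coprod_heap : heapModType T := assoc_heap coprod_pointed.

Definition coprod_incl (i : I) (x : G i) : coprod_heap :=
  let u : coprod_pointed :=
    (dsum_inj (G := fun i => pointed_at (e i) : pointedModType T) x, 0) in
  match pselect (i <> i0) with
  | left ii0 => u + (0, b (exist _ i ii0))
  | right _ => u
  end.

End Candidate.

(* Main.v *)
(** A morphism of heaps of modules out of C is, once the base point of its
    target is moved to the image of 0, the same thing as a morphism of pointed
    modules.  With o := f_{i0}(e_{i0}) as the base point of H, such a morphism
    C -> H extends the f_i exactly when it sends u_i(x) to f_i(x) - f_i(e_i)
    and b_i to f_i(e_i); the first family of values determines it on the direct
    sum, the second one on F.  The index i0 carries no basis element because
    f_{i0}(e_{i0}) = o is already the zero of H. *)
Require Import Defs.
From mathcomp Require Import all_boot all_algebra.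
From mathcomp Require Import mathcomp_extra boolp classical_sets.
From mathcomp Require Import cardinality fsbigop.

Set Implicit Arguments.
Unset Strict Implicit.
Unset Printing Implicit Defensive.
Import GRing.Theory.
Local Open Scope classical_set_scope.
Local Open Scope ring_scope.

(** * Morphisms of pointed modules *)

Section PointedMorphisms.
Context {T : trussType}.
Implicit Types G K L : pointedModType T.

Lemma pointedMod_morphism0 G K (f : G -> K) : pointedMod_morphism f -> f 0 = 0.
Proof. by case=> fD _; apply: (addrI (f 0)); rewrite -fD !addr0. Qed.

Lemma pointedMod_morphismB G K (f : G -> K) : pointedMod_morphism f ->
  {morph f : x y / x - y}.
Proof.
by move=> [fD _] x y; apply: (addIr (f y)); rewrite -fD !subrK.
Qed.

Lemma pointedMod_morphism_comp G K L (f : G -> K) (g : K -> L) :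
  pointedMod_morphism f -> pointedMod_morphism g -> pointedMod_morphism (g \o f).
Proof.
by move=> [fD fZ] [gD gZ]; split=> [x y|t x] /=; rewrite (fD, fZ) (gD, gZ).
Qed.

Lemma pointedMod_morphism_pairl G K :
  pointedMod_morphism (fun x : G => (x, 0) : G * K).
Proof. by split=> [x y|t x]; congr pair; rewrite /= ?addr0 ?pact0. Qed.

Lemma pointedMod_morphism_pairr G K :
  pointedMod_morphism (fun y : K => (0, y) : G * K).
Proof. by split=> [x y|t x]; congr pair; rewrite /= ?addr0 ?pact0. Qed.

Lemma pointedMod_morphism_copair G K L (f : G -> L) (g : K -> L) :
  pointedMod_morphism f -> pointedMod_morphism g ->
  pointedMod_morphism (fun z : G * K => f z.1 + g z.2).
Proof.
move=> [fD fZ] [gD gZ]; split=> [x y|t x] /=.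
  by rewrite fD gD addrACA.
by rewrite fZ gZ pactDr.
Qed.

End PointedMorphisms.

(** * Recovering a heap of modules from its pointed module at a base point *)

Section PointedAtTheory.
Context {T : trussType} {M : heapModType T} (o : M).
Implicit Types x y z : pointed_at o.

Lemma pointed_at_pactE (t : T) x : pact t x = tri t o (x : M). Proof. by []. Qed.

(** Unfolded, the right side is [[[x, o, [o, y, o]], o, z]], where every [o] cancels; hence the
    formula holds for any base point. *)
Lemma pointed_at_brkE x y z : brk (x : M) y z = x - y + z.
Proof.
rewrite /GRing.add /= /GRing.opp /=.
by rewrite !brkA brkrK -[in RHS]brkA brklK.
Qed.

Lemma pointed_at_triE (t : T) x y : tri t (x : M) y = pact t y - pact t x + x.
Proof. by rewrite (tri_base t (x : M) y o) !pointed_at_pactE -pointed_at_brkE. Qed.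

End PointedAtTheory.

(** * Passing between heap and pointed morphisms *)

Section AssocHeapMorphisms.
Context {T : trussType}.
Implicit Types (G : pointedModType T) (M N : heapModType T).

Lemma assoc_brkE G (x y z : assoc_heap G) : brk x y z = (x : G) - y + z.
Proof. by []. Qed.

Lemma assoc_triE G (t : T) (x y : assoc_heap G) :
  tri t x y = pact t (y : G) - pact t (x : G) + x.
Proof. by []. Qed.

Lemma heapMod_morphism_from_pointed G M (o : M) (f : G -> pointed_at o) :
  pointedMod_morphism f -> @heapMod_morphism T (assoc_heap G) M f.
Proof.
move=> fm; have [fD fZ] := fm; have fB := pointedMod_morphismB fm.
split=> [x y z|t x y].
  by rewrite assoc_brkE fD fB -pointed_at_brkE.
by rewrite assoc_triE fD fB !fZ -pointed_at_triE.
Qed.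

(** Sum and action are the heap operations based at zero: [x + y = [x, 0, y]], and [t] acts on [x]
    as [tri t 0 x]. *)
Lemma pointed_from_heapMod_morphism G M (o : M) (f : G -> pointed_at o) :
  f 0 = o -> @heapMod_morphism T (assoc_heap G) M f -> pointedMod_morphism f.
Proof.
move=> f0 [fB fT]; have {}f0 : f 0 = 0 by [].
split=> [x y|t x].
  have := fB x 0 y; rewrite assoc_brkE subr0 => ->.
  by rewrite (pointed_at_brkE (f x)) f0 subr0.
have := fT t 0 x; rewrite assoc_triE pact0 subr0 addr0 => ->.
by rewrite (pointed_at_triE t (f 0)) f0 pact0 subr0 addr0.
Qed.

(** The constant cancels in each difference and survives once, in the last summand. This makes the
    maps [u_i + b_i] morphisms. *)
Lemma heapMod_morphism_translate M (o : M) G (f : pointed_at o -> G) (c : G) :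
  pointedMod_morphism f ->
  @heapMod_morphism T M (assoc_heap G) (fun x => f x + c).
Proof.
move=> fm; have [fD fZ] := fm; have fB := pointedMod_morphismB fm.
have subDD (u v w : G) : (u + w) - (v + w) = u - v.
  by rewrite opprD addrACA subrr addr0.
split=> [x y z|t x y].
  by rewrite (pointed_at_brkE (x : pointed_at o)) assoc_brkE fD fB subDD addrA.
rewrite (pointed_at_triE t (x : pointed_at o)) assoc_triE fD fB !fZ !pactDr subDD.
by rewrite addrA.
Qed.

Lemma pointedMod_morphism_recenter M N (e : M) (o : N) (f : M -> N) :
  heapMod_morphism f ->
  pointedMod_morphism (fun x : pointed_at e =>
    (f x : pointed_at o) - (f e : pointed_at o)).
Proof.
move=> [fB fT]; split=> [x y|t x].
  have -> : f (x + y) = brk (f x) (f e) (f y) by rewrite -fB.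
  by rewrite (pointed_at_brkE (f x : pointed_at o)) -addrA.
by rewrite pointed_at_pactE fT (pointed_at_triE t (f e : pointed_at o)) addrK -pactB.
Qed.

End AssocHeapMorphisms.

(** * The universal property of the direct sum *)

Section DirectSumTheory.
Context {T : trussType} {I : Type} {G : I -> pointedModType T}.
Implicit Types (x y : dsum G) (K : pointedModType T).

Lemma dsumDE x y i : (x + y) i = x i + y i. Proof. by []. Qed.

Lemma dsumNE x i : (- x) i = - x i. Proof. by []. Qed.

Lemma dsumZE (t : T) x i : (pact t x : dsum G) i = pact t (x i).
Proof. by []. Qed.

Lemma dsum_injE i (a : G i) : dsum_inj a i = a.
Proof. exact: (@dfwithin {classic I}). Qed.

Lemma dsum_inj_neq i j (a : G i) : i <> j -> dsum_inj a j = 0.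
Proof. by move=> ij; apply: (@dfwithout {classic I}); apply/eqP. Qed.

Lemma dsum_inj_morphism i : pointedMod_morphism (@dsum_inj T I G i).
Proof.
split=> [a c|t a]; apply: dsumP => j; rewrite ?(dsumDE, dsumZE);
  have [<-|ij] := pselect (i = j); rewrite ?dsum_injE// !dsum_inj_neq//.
  by rewrite addr0.
by rewrite pact0.
Qed.

Lemma dsum_ind (P : dsum G -> Prop) : P 0 ->
  (forall i (a : G i) x, P x -> P (dsum_inj a + x)) -> forall x, P x.
Proof.
move=> P0 PD x.
have /(@finite_seqP {classic I})[s xs] := dsum_fin x.
(* Inclusion of the support in [s] survives removing the component at the head of [s], even if [s]
   has repetitions. *)
have {xs} : forall i : {classic I}, x i <> 0 -> i \in s.
  by move=> i xi; have : [set i | x i <> 0] i by []; rewrite xs.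
elim: s x => [|j s IH] x xs.
  suff -> : x = 0 by [].
  by apply: dsumP => i; apply: contrapT => /xs.
rewrite -(subrK (dsum_inj (x j)) x) addrC; apply: PD; apply: IH => i.
rewrite dsumDE dsumNE; have [<-|ji] := pselect (j = i).
  by rewrite dsum_injE subrr.
rewrite dsum_inj_neq// subr0 => /xs; rewrite inE => /orP[/eqP ij|//].
by case: ji.
Qed.

Lemma dsum_morphism_ext K (f g : dsum G -> K) :
  pointedMod_morphism f -> pointedMod_morphism g ->
  (forall i (a : G i), f (dsum_inj a) = g (dsum_inj a)) -> f =1 g.
Proof.
move=> fm gm fg; apply: dsum_ind => [|i a x fgx].
  by rewrite !pointedMod_morphism0.
by rewrite fm.1 gm.1 fgx fg.
Qed.

(* [\sum_(i \in A)] is 0 when infinitely many terms are nonzero, so this is the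
   intended sum only if [g i 0 = 0] for all [i]. *)
Definition dsum_lift K (g : forall i, G i -> K) x : K :=
  \sum_(i \in [set: {classic I}]) g i (x i).

Lemma dsum_liftE K (g : forall i, G i -> K) (A : set {classic I}) x :
    (forall i, g i 0 = 0) -> [set i | x i <> 0] `<=` A ->
  dsum_lift g x = \sum_(i \in A) g i (x i).
Proof.
move=> g0 xA; apply/esym/fsbig_widen => // i [_ Ai] /=.
by rewrite (_ : x i = 0) ?g0//; apply: contrapT => /xA.
Qed.

Lemma dsum_lift_inj K (g : forall i, G i -> K) i (a : G i) :
  (forall j, g j 0 = 0) -> dsum_lift g (dsum_inj a) = g i a.
Proof.
move=> g0; rewrite (@dsum_liftE _ _ [set i])//.
  by rewrite fsbig_set1 dsum_injE.
by move=> j; apply: contra_notP => ij; rewrite dsum_inj_neq// => /esym.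
Qed.

Lemma dsum_lift_morphism K (g : forall i, G i -> K) :
  (forall i, pointedMod_morphism (g i)) -> pointedMod_morphism (dsum_lift g).
Proof.
move=> gm; have g0 i : g i 0 = 0 by exact: pointedMod_morphism0.
have liftD : {morph dsum_lift g : x y / x + y}.
  (* The finite set [A] contains the supports of [x], [y] and [x + y], so all three sums can be
     taken over it. *)
  move=> x y; pose A : set {classic I} :=
    [set i | x i <> 0] `|` [set i | y i <> 0].
  rewrite !(@dsum_liftE _ g A)//; last first.
  - move=> i /= xyi; have [xi|] := pselect (x i = 0); last by left.
    by right=> yi; apply: xyi; rewrite xi yi addr0.
  - by move=> i; left.
  - by move=> i; right.
  rewrite -fsbig_split/=; last by rewrite finite_setU; split; exact: dsum_fin.
  by apply: eq_fsbigr => i _; exact: (gm i).1.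
(* Additivity being known, compatibility with the action reduces to single components. *)
split=> // t; apply: dsum_ind => [|i a x IH].
  by rewrite pact0 /dsum_lift fsbig1 ?pact0.
rewrite pactDr !liftD pactDr IH -(dsum_inj_morphism i).2.
by rewrite !dsum_lift_inj// (gm i).2.
Qed.

End DirectSumTheory.

Theorem mainTheorem6 (T : trussType) (I : Type) (G : I -> heapModType T)
    (e : forall i, G i) (i0 : I) (F : pointedModType T)
    (b : {i : I | i <> i0} -> F) (Ffree : is_free_pointedMod b) :
  is_coproduct (coprod_incl e b).
Proof.
pose Ge i : pointedModType T := pointed_at (e i).
(* Extending [b] by 0 at [i0] gives every inclusion the same form [(u_i x, c i)]. *)
pose c i : F := if pselect (i <> i0) is left ii0 then b (exist _ i ii0) else 0.
have inclE i (x : G i) : coprod_incl e b x = (@dsum_inj T I Ge i x, c i).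
  rewrite /coprod_incl /c; case: pselect => // ii0.
  by congr pair; rewrite /= ?addr0 ?add0r.
have c_b j : c (sval j) = b j.
  case: j => i ii0; rewrite /c /=; case: pselect => // ii0'.
  by congr (b (exist _ i _)); exact: Prop_irrelevance.
have c_i0 : c i0 = 0 by rewrite /c; case: pselect.
split=> [i|H f fm].
  have -> : @coprod_incl T I G e i0 F b i =
      fun x : Ge i => (@dsum_inj T I Ge i x, 0) + (0, c i).
    by apply/funext => x; rewrite inclE; congr pair; rewrite /= ?addr0 ?add0r.
  apply: heapMod_morphism_translate.
  exact: pointedMod_morphism_comp (dsum_inj_morphism i)
                                  (pointedMod_morphism_pairl _ _).
pose o := f i0 (e i0); pose P : pointedModType T := pointed_at o.
pose g i (x : Ge i) : P := (f i x : P) - (f i (e i) : P).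
have gm i : pointedMod_morphism (g i).
  exact: pointedMod_morphism_recenter (fm i).
have g0 i : g i 0 = 0 by exact: pointedMod_morphism0.
have [phi [[phim phib] phiU]] := Ffree P (fun j => f (sval j) (e (sval j))).
have phic i : phi (c i) = f i (e i).
  (* At [i0] both sides are the zero of [P], which is [f i0 (e i0)] by definition. *)
  have [->|ii0] := pselect (i = i0); first by rewrite c_i0 pointedMod_morphism0.
  by rewrite (c_b (exist _ i ii0)) phib.
exists (fun z => dsum_lift g z.1 + phi z.2); split.
  split=> [|i x].
    apply: heapMod_morphism_from_pointed.
    exact: pointedMod_morphism_copair (dsum_lift_morphism gm) phim.
  by rewrite inclE /= dsum_lift_inj// phic subrK.
move=> h [hm hf]; pose h' : coprod_pointed e F -> P := h.
have h'c i x : h' (@dsum_inj T I Ge i x, c i) = f i x.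
  by rewrite -hf inclE.
have h'm : pointedMod_morphism h'.
  apply: pointed_from_heapMod_morphism hm.
  (* Zero is the image of [e i0] under the inclusion at [i0], so [h] sends it to [o]. *)
  rewrite -[RHS]h'c c_i0; congr (h' (_, _)).
  by rewrite (pointedMod_morphism0 (dsum_inj_morphism i0)).
have h'rm := pointedMod_morphism_comp (pointedMod_morphism_pairr _ _) h'm.
have h'lm := pointedMod_morphism_comp (pointedMod_morphism_pairl _ _) h'm.
have h'F i : h' (0, c i) = f i (e i).
  by rewrite -h'c (pointedMod_morphism0 (dsum_inj_morphism i)).
have phih : phi = fun y => h' (0, y).
  by apply: phiU; split=> // j; rewrite -c_b h'F.
apply/funext => -[x y].
have -> : h (x, y) = h' (x, 0) + h' (0, y).
  by rewrite -h'm.1; congr (h' (_, _)); rewrite /= ?addr0 ?add0r.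
rewrite phih; suff -> : dsum_lift g x = h' (x, 0) by []; move: x {y}.
apply: (dsum_morphism_ext (dsum_lift_morphism gm) h'lm) => i a /=.
(* Here [f i a - f i (e i)] is the difference of the values of [h'] at [(u_i a, c i)] and
   [(0, c i)], in which [c i] cancels. *)
rewrite dsum_lift_inj// /g -h'F -(h'c i a) -(pointedMod_morphismB h'm).
by congr (h' (_, _)); rewrite /= ?subr0 ?subrr.
Qed.
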